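(* Let $\mathcal{A}$ be a zero product determined $\star$-algebra over $\mathbb{C}$ with unity $1$, and let $\varphi : \mathcal{A} \to \mathcal{A}$ be a linear map. Then the following conditions are equivalent: (i) $\varphi$ is a left centralizer, i.e. $\varphi(ab) = \varphi(a)b$ for all $a, b \in \mathcal{A}$; (ii) for all $a, b \in \mathcal{A}$, if $a b^\star = 0$ then $a\,\varphi(b)^\star = 0$.
   Context: All algebras and vector spaces are over the complex field $\mathbb{C}$; algebras are associative. A $\star$-algebra is an algebra equipped with a conjugate-linear involution $a \mapsto a^\star$ satisfying $(ab)^\star = b^\star a^\star$ and $(a^\star)^\star = a$. A linear map $\varphi : \mathcal{A} \to \mathcal{A}$ is a left centralizer if $\varphi(ab) = \varphi(a)b$ for all $a, b \in \mathcal{A}$. For an algebra $\mathcal{A}$, $\mathcal{A}^2$ denotes the linear span of all products $ab$ with $a,b \in \mathcal{A}$. The algebra $\mathcal{A}$ is called zero product determined if for every linear space $\mathcal{X}$ and every bilinear map $\phi : \mathcal{A} \times \mathcal{A} \to \mathcal{X}$ the following holds: if $\phi(a,b) = 0$ whenever $ab = 0$, then there exists a linear map $T : \mathcal{A}^2 \to \mathcal{X}$ such that $\phi(a,b) = T(ab)$ for all $a, b \in \mathcal{A}$. *)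

(* Defs.v *)
From HB Require Import structures.
From mathcomp Require Import all_boot all_order all_algebra.
From mathcomp Require Import boolp reals complex.

Set Implicit Arguments.
Unset Strict Implicit.
Unset Printing Implicit Defensive.

Import GRing.Theory Num.Theory.
Local Open Scope ring_scope.

Reserved Notation "a ** b" (at level 40, left associativity).

(* Associative algebras, possibly without unity and possibly zero.  MathComp's
   algType has a unity and requires 1 != 0. *)
HB.mixin Record Lmodule_isAssocAlgebra (K : fieldType) A
    of GRing.Lmodule K A := {
  amul : A -> A -> A;
  amulA : associative amul;
  amulDl : left_distributive amul +%R;
  amulDr : right_distributive amul +%R;
  amulZl : forall (c : K) (a b : A), amul (c *: a) b = c *: amul a b;
  amulZr : forall (c : K) (a b : A), amul a (c *: b) = c *: amul a b
}.

#[short(type="assocAlgType")]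
HB.structure Definition AssocAlgebra (K : fieldType) :=
  {A of GRing.Lmodule K A & Lmodule_isAssocAlgebra K A}.

Notation "a ** b" := (amul a b) : ring_scope.

Definition is_unity (K : fieldType) (A : assocAlgType K) (e : A) : Prop :=
  left_id e (@amul K A) /\ right_id e (@amul K A).

HB.mixin Record AssocAlgebra_isStarAlgebra (R : realType) A
    of AssocAlgebra R[i] A := {
  star : A -> A;
  starD : {morph star : a b / a + b};
  starZ : forall (c : R[i]) (a : A), star (c *: a) = Num.conj c *: star a;
  starM : forall a b : A, star (a ** b) = star b ** star a;
  starK : involutive star
}.

#[short(type="starAlgType")]
HB.structure Definition StarAlgebra (R : realType) :=
  {A of AssocAlgebra R[i] A & AssocAlgebra_isStarAlgebra R A}.

Section SquareSubspace.
Variables (K : fieldType) (A : assocAlgType K).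

Definition square_pred : {pred A} := fun x =>
  `[< exists (n : nat) (c : 'I_n -> K) (a b : 'I_n -> A),
        x = \sum_(i < n) c i *: (a i ** b i) >].

Lemma square_pred_closed : submod_closed square_pred.
Proof.
split=> [|k _ _ /asboolP[n [c [a [b ->]]]] /asboolP[m [d [e [f ->]]]]].
  by apply/asboolP; exists 0%N, (fun=> 0), (fun=> 0), (fun=> 0); rewrite big_ord0.
pose cat T (g : 'I_n -> T) (h : 'I_m -> T) (i : 'I_(n + m)) :=
  match split i with inl j => g j | inr j => h j end.
apply/asboolP; exists (n + m)%N, (cat K (fun i => k * c i) d),
  (cat A a e), (cat A b f).
rewrite big_split_ord scaler_sumr /cat; congr (_ + _); apply: eq_bigr => i _.
  by rewrite (unsplitK (inl i : 'I_n + 'I_m)%type) scalerA.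
by rewrite (unsplitK (inr i : 'I_n + 'I_m)%type).
Qed.

HB.instance Definition _ :=
  GRing.isSubmodClosed.Build K A square_pred square_pred_closed.

(* The vector space A^2. *)
Record square := Square { square_val :> A; _ : square_val \in square_pred }.

HB.instance Definition _ := [isSub for square_val].
HB.instance Definition _ := [Choice of square by <:].
HB.instance Definition _ := [SubChoice_isSubLmodule of square by <:].

Lemma amul_in_square (a b : A) : a ** b \in square_pred.
Proof.
apply/asboolP; exists 1%N, (fun=> 1), (fun=> a), (fun=> b).
by rewrite big_ord1 scale1r.
Qed.

Definition square_mul (a b : A) : square := Square (amul_in_square a b).

End SquareSubspace.

Definition zero_product_determined (K : fieldType) (A : assocAlgType K) : Prop :=
  forall (X : lmodType K) (phi : {bilinear A -> A -> X}),
    (forall a b : A, a ** b = 0 -> phi a b = 0) ->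
    exists T : {linear square A -> X},
      forall a b : A, phi a b = T (square_mul a b).

Definition left_centralizer (K : fieldType) (A : assocAlgType K)
    (phi : {linear A -> A}) : Prop :=
  forall a b : A, phi (a ** b) = phi a ** b.

(* Main.v *)
(** Testing zero product determination on the bilinear map
    (a, b) |-> a phi(b^star)^star, which vanishes when ab = 0 by (ii), shows
    that it depends only on ab.  Comparing (a, b) with (1, ab) and taking stars
    gives phi(b^star) a^star = phi(b^star a^star). *)
From HB Require Import structures.
Require Import Defs.
From mathcomp Require Import all_boot all_order all_algebra.
From mathcomp Require Import reals complex.

Import GRing.Theory Num.Theory.
Local Open Scope ring_scope.

Section StarConjugate.
Context {R : realType} {A : starAlgType R}.

(** Two stars, so that the two conjugations of scalars cancel and the map is complex linear. *)
Definition star_conjugate (phi : {linear A -> A}) (b : A) : A :=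
  star (phi (star b)).

Definition mul_star_conjugate (phi : {linear A -> A}) (a b : A) : A :=
  a ** star_conjugate phi b.

Lemma mul_star_conjugate_bilinear (phi : {linear A -> A}) :
  bilinear_for *:%R *:%R (mul_star_conjugate phi).
Proof.
rewrite /mul_star_conjugate; split=> [b k a a' | a k b b'] /=.
  by rewrite amulDl amulZl.
by rewrite /star_conjugate starD starZ linearP starD starZ conjCK amulDr amulZr.
Qed.

HB.instance Definition _ (phi : {linear A -> A}) :=
  bilinear_isBilinear.Build R[i] A A A *:%R *:%R
    (mul_star_conjugate phi) (mul_star_conjugate_bilinear phi).

End StarConjugate.

(** Both pairs have the same product, since [e ** (a ** b) = a ** b], so the linear map [T] on the
    square takes the same value at both. *)
Lemma zero_product_determined_balanced (K : fieldType) (A : assocAlgType K)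
    (e : A) (X : lmodType K) (f : {bilinear A -> A -> X}) :
  zero_product_determined A -> left_id e (@amul K A) ->
  (forall a b : A, a ** b = 0 -> f a b = 0) ->
  forall a b : A, f a b = f e (a ** b).
Proof.
move=> zpdA mul1 /zpdA[T fE] a b; rewrite !fE; congr (T _).
by apply: val_inj; rewrite /= mul1.
Qed.

Theorem theorem2p1 (R : realType) (A : starAlgType R) (e : A)
    (unity_e : is_unity e) (zpdA : zero_product_determined A)
    (phi : {linear A -> A}) :
  left_centralizer phi <->
  (forall a b : A, a ** star b = 0 -> a ** star (phi b) = 0).
Proof.
case: unity_e => mul1 _; split=> [phiM a b ab0 | phi0 a b].
  (* Since [phi b = phi e ** b], the product becomes [(a ** star b) ** star (phi e)]. *)
  rewrite -[b]mul1 phiM starM amulA ab0.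
  (* Zero absorbs on the left by homogeneity, once written as [0 *: 0]. *)
  by rewrite -[X in X ** _](scale0r (0 : A)) amulZl scale0r.
have f0 (x y : A) : x ** y = 0 -> mul_star_conjugate phi x y = 0.
  by move=> xy0; apply: phi0; rewrite starK.
(* The arguments are starred and swapped so that the final star returns
   [phi a ** b = phi (a ** b)]. *)
have := zero_product_determined_balanced _ _ _ _ _ zpdA mul1 f0 (star b) (star a).
rewrite /= /mul_star_conjugate /star_conjugate mul1 => /(congr1 (@star R A)).
by rewrite !starM !starK.
Qed.
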